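(* Let $b\in[0,1)$ and, for $n\in\mathbb{N}$, let $e(n,b)\in\mathscr{E}$ be the critical number determined by $(n+b)^2\in\{e(n,b)\}\cup\mathscr{I}^{e(n,b)}$. For $e\in\mathscr{E}$ let $$\kappa(e)=-\tfrac12\,(2\lfloor\sqrt{e/2}\rfloor+1)^2\,\mathcal{T}'(e).$$ Then, as $n\to\infty$ (with $b$ fixed), $$\kappa(e(n,b))\to\begin{cases}4 & \text{if } b=0,\\ 0 & \text{otherwise.}\end{cases}$$
   Context: Let $P(x)=\lfloor x\rfloor^2+(2\lfloor x\rfloor+1)\{x\}$ for $x\in\mathbb{R}$, with $\{x\}=x-\lfloor x\rfloor$, and let $H:\mathbb{R}^2\to\mathbb{R}$ be the piecewise-affine Hamiltonian $H(x,y)=P(x)+P(y)$. Off the lines $x\in\mathbb{Z}$, $y\in\mathbb{Z}$ its Hamiltonian vector field is $\mathbf{w}(x,y)=(2\lfloor y\rfloor+1,\,-(2\lfloor x\rfloor+1))$. For $\alpha>0$ the level set $\Pi(\alpha)=\{z : H(z)=\alpha\}$ is a closed convex polygon, along which the flow moves with velocity $\mathbf{w}$ on each edge, continuing continuously through the vertices. $\mathcal{T}(\alpha)$ is the period of the flow on $\Pi(\alpha)$; explicitly $$\frac{\mathcal{T}(\alpha)}{8}=\frac{P^{-1}(\alpha/2)}{2\lfloor\sqrt{\alpha/2}\rfloor+1}-2\sum_{n=\lfloor\sqrt{\alpha/2}\rfloor+1}^{\lfloor\sqrt{\alpha}\rfloor}\frac{P^{-1}(\alpha-n^2)}{4n^2-1},\qquad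 P^{-1}(x)=\frac{x+\lfloor\sqrt{x}\rfloor(1+\lfloor\sqrt{x}\rfloor)}{2\lfloor\sqrt{x}\rfloor+1}\ (x\ge 0),$$ with an empty sum equal to $0$. $\mathscr{E}=\{e_i : i\ge 0\}=\{0,1,2,4,5,8,9,\dots\}$ is the increasing enumeration of the non-negative integers that are sums of two integer squares (the critical numbers), and $\mathscr{I}^{e_i}=(e_i,e_{i+1})$. The derivative of $\mathcal{T}$ is constant on each open interval $\mathscr{I}^e$, and $\mathcal{T}'(e)$ denotes this constant value. *)

(* Defs.v *)
From HB Require Import structures.
From mathcomp Require Import all_boot all_order all_algebra.
From mathcomp Require Import all_classical all_reals all_analysis.
From mathcomp Require Import zify ring lra.
Set Implicit Arguments.
Unset Strict Implicit.
Unset Printing Implicit Defensive.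
Import Order.TTheory GRing.Theory Num.Theory.
Import numFieldNormedType.Exports.
Local Open Scope classical_set_scope.
Local Open Scope ring_scope.

(* On nonnegative reals [Num.truncn] is the floor, as a natural number. *)
Definition fsqrt (R : realType) (x : R) : nat := Num.truncn (Num.sqrt x).

Definition P (R : realType) (x : R) : R :=
  let m : R := (Num.floor x)%:~R in m ^+ 2 + (2 * m + 1) * (x - m).

(* Inverse of the restriction of [P] to the nonnegative reals (see [PinvK]);
   only meaningful for [0 <= x]. *)
Definition Pinv (R : realType) (x : R) : R :=
  let m : R := (fsqrt x)%:R in (x + m * (1 + m)) / (2 * m + 1).

Lemma PinvK (R : realType) (x : R) : 0 <= x -> P (Pinv x) = x.
Proof.
move=> x0; rewrite /P /Pinv /fsqrt; set k := Num.truncn _.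
have /andP[k1 k2] := truncn_itv (sqrtr_ge0 x); rewrite -/k in k1 k2.
have sE := sqr_sqrtr x0; set s := Num.sqrt x in k1 k2 sE.
have m0 : (0 : R) <= k%:R by rewrite ler0n.
have d0 : 0 < 2 * k%:R + 1 :> R by lra.
rewrite -natr1 in k2.
have -> : Num.floor ((x + k%:R * (1 + k%:R)) / (2 * k%:R + 1) : R) = k%:Z.
  apply: floor_def; rewrite intrD -!pmulrn.
  by rewrite ler_pdivlMr // ltr_pdivrMr //; apply/andP; split; nra.
by rewrite -pmulrn; field; rewrite gt_eqF.
Qed.

(* The period of the flow of the piecewise-affine Hamiltonian [P x + P y] on
   its level set of value [alpha > 0], in closed form. *)
Definition period (R : realType) (alpha : R) : R :=
  let m := fsqrt (alpha / 2) in
  8 * (Pinv (alpha / 2) / (2 * m%:R + 1)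
       - 2 * \sum_(m.+1 <= n < (fsqrt alpha).+1)
               Pinv (alpha - n%:R ^+ 2) / (4 * n%:R ^+ 2 - 1)).

Definition crit : set nat :=
  [set e | exists a b : int, e%:Z = a ^+ 2 + b ^+ 2].

Lemma ex_crit_gt (e : nat) : exists m, `[< crit m >] && (e < m)%N.
Proof.
exists (e.+1 ^ 2)%N; apply/andP; split; last by nia.
by apply/asboolP; exists e.+1%:Z, 0; rewrite expr0n addr0; lia.
Qed.

(* The least critical number exceeding [e]: it is e_(i+1) when [e] is e_i in
   the increasing enumeration of [crit]. *)
Definition next_crit (e : nat) : nat := ex_minn (ex_crit_gt e).

Definition crit_itv (R : realType) (e : nat) : set R :=
  `]e%:R, (next_crit e)%:R[%classic.

(* [period] is affine on each [crit_itv e] with [crit e]: this is its slope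
   there.  The default value 0 is never used for such an [e]. *)
Definition dperiod (R : realType) (e : nat) : R :=
  xget 0 [set c : R | forall alpha : R, crit_itv e alpha ->
                        is_derive alpha 1 (@period R) c].

Definition kappa (R : realType) (e : nat) : R :=
  - (1 / 2) * (2 * (fsqrt (e%:R / 2 : R))%:R + 1) ^+ 2 * dperiod R e.

Definition crit_at (R : realType) (n : nat) (b : R) : nat :=
  xget 0%N [set e | crit e /\ ([set e%:R] `|` crit_itv e) ((n%:R + b) ^+ 2)].

(* Main.v *)
Require Import Defs.
From HB Require Import structures.
From mathcomp Require Import all_boot all_order all_algebra.
From mathcomp Require Import all_classical all_reals all_analysis.
From mathcomp Require Import ring lra.
Set Implicit Arguments.
Unset Strict Implicit.
Unset Printing Implicit Defensive.
Import Order.TTheory GRing.Theory Num.Theory.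
Import numFieldNormedType.Exports.
Local Open Scope classical_set_scope.
Local Open Scope ring_scope.

(** As long as [alpha] stays in a critical interval, none of the integer square
roots in [period] changes, because each of them jumps only at a sum of two
squares.  So [period] is affine there.  With [E] the left end of the interval,
[m] and [N] the integer square roots of [E / 2] and [E], and [k_n] that of
[E - n^2], reading off the slope gives ([kappaE])
  kappa = - 2 + 8 (2m+1)^2 * sum_(m < n <= N) 1 / ((2 k_n + 1) (4 n^2 - 1)).

Up to lower order the sum over [n < N] is a Riemann sum of
1 / (8 x^2 sqrt(E - x^2)) over the interval from sqrt(E/2) to sqrt E, whose
integral is exactly 1 / (8 E): an antiderivative of 1 / (x^2 sqrt(E - x^2)) is
- sqrt(E - x^2) / (E x).  As (2m+1)^2 is about 2E, these edges contribute 2 and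
cancel the constant - 2.  The integrand is neither monotone nor bounded, so the
comparison with the integral is replaced by a telescoping one: the decrease of
sqrt(E - x^2) / x over a unit step is trapped between E / (x (x+1) sqrt(E - y^2))
for y = x and y = x + 1 ([height_drop_ge], [height_drop_le]), as follows from
the inequality between arithmetic and geometric means.  Replacing the integer
square root [k_n] by the real one is harmless, since for [n < N] the latter is
at least sqrt N, which makes the relative error uniformly O(1 / sqrt N)
([weight_le], [weight_ge]).

The edge [n = N] is the only one on which [k_n] may stay bounded; it contributes
about 4 / (2 k_N + 1).  Hence kappa = 4 / (2 k_N + 1) + O(1 / sqrt N)
([kappa_approx]).

For the critical number of (n + b)^2 one has [N = n], and [k_N] is the integer
square root of 2nb + b^2: the numbers (n + b)^2 and e(n, b) lie on the same side
of every sum of two squares.  This is 0 for [b = 0], which leaves the limit 4,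
and it tends to infinity like sqrt n otherwise, which leaves the limit 0. *)

(** * Integer square roots and critical numbers *)

Lemma fsqrt_geE (R : realType) (k : nat) (x : R) :
  0 <= x -> (k <= fsqrt x)%N = (k%:R ^+ 2 <= x).
Proof.
move=> x0; rewrite /fsqrt truncn_ge_nat ?sqrtr_ge0 //.
by rewrite -[k%:R]ger0_norm ?ler0n // -sqrtr_sqr ler_sqrt // sqrtr_sqr ger0_norm.
Qed.

Lemma fsqrt_itv (R : realType) (x : R) : 0 <= x ->
  (fsqrt x)%:R <= Num.sqrt x < (fsqrt x)%:R + 1.
Proof. by move=> x0; rewrite natr1; apply: truncn_itv; apply: sqrtr_ge0. Qed.

Lemma fsqrt_sqr_itv (R : realType) (x : R) : 0 <= x ->
  (fsqrt x)%:R ^+ 2 <= x < ((fsqrt x)%:R + 1) ^+ 2.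
Proof.
move=> x0; rewrite natr1 -fsqrt_geE // leqnn ltNge -fsqrt_geE //.
by rewrite ltnn.
Qed.

Lemma eq_fsqrt (R : realType) (x y : R) : 0 <= x -> 0 <= y ->
  (forall k : nat, (k%:R ^+ 2 <= x) = (k%:R ^+ 2 <= y)) -> fsqrt x = fsqrt y.
Proof.
move=> x0 y0 xy; apply/eqP; rewrite eqn_leq.
by rewrite fsqrt_geE // -xy -fsqrt_geE // leqnn fsqrt_geE // xy -fsqrt_geE /=.
Qed.

Lemma crit_sum2 (a b : nat) : crit (a ^ 2 + b ^ 2)%N.
Proof. by exists a%:Z, b%:Z; rewrite PoszD -!rmorphXn. Qed.

Lemma next_crit_gt (e : nat) : (e < next_crit e)%N.
Proof. by rewrite /next_crit; case: ex_minnP => m /andP[]. Qed.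

(** Moving inside a critical interval never crosses a critical number; this is
what freezes every integer square root occurring in the period. *)
Lemma crit_leE (R : realType) (e c : nat) (x : R) : crit c ->
  e%:R <= x < (next_crit e)%:R -> (c%:R <= x) = (c <= e)%N.
Proof.
move=> cc /andP[ex xn]; apply/idP/idP => [cx|ce]; last first.
  by apply: le_trans ex; rewrite ler_nat.
rewrite leqNgt; apply/negP => ec.
have : (c%:R : R) < (next_crit e)%:R by apply: le_lt_trans xn.
rewrite ltr_nat ltnNge => /negP; apply.
rewrite /next_crit; case: ex_minnP => m _; apply.
by rewrite ec andbT; apply/asboolP.
Qed.

Lemma fsqrt_half (R : realType) (e : nat) (x : R) :
  e%:R <= x < (next_crit e)%:R -> fsqrt (x / 2) = fsqrt (e%:R / 2 : R).
Proof.
move=> xI; have /andP[ex _] := xI.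
have e0 : (0 : R) <= e%:R by [].
apply: eq_fsqrt => [| |k]; [lra|lra|].
have E (y : R) : (k%:R ^+ 2 <= y / 2) = ((k ^ 2 + k ^ 2)%N%:R <= y).
  by rewrite natrD natrX; apply/idP/idP => ?; lra.
by rewrite !E (crit_leE (crit_sum2 k k) xI) ler_nat.
Qed.

Lemma fsqrt_sub_sqr (R : realType) (e n : nat) (x : R) : (n ^ 2 <= e)%N ->
  e%:R <= x < (next_crit e)%:R ->
  fsqrt (x - n%:R ^+ 2) = fsqrt (e%:R - n%:R ^+ 2 : R).
Proof.
move=> ne xI; have /andP[ex _] := xI.
have e0 : n%:R ^+ 2 <= e%:R :> R by rewrite -natrX ler_nat.
apply: eq_fsqrt => [| |k]; [lra|lra|].
have E (y : R) : (k%:R ^+ 2 <= y - n%:R ^+ 2) = ((k ^ 2 + n ^ 2)%N%:R <= y).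
  by rewrite natrD !natrX; apply/idP/idP => ?; lra.
by rewrite !E (crit_leE (crit_sum2 k n) xI) ler_nat.
Qed.

Lemma fsqrt_crit (R : realType) (e : nat) (x : R) :
  e%:R <= x < (next_crit e)%:R -> fsqrt x = fsqrt (e%:R : R).
Proof.
move=> xI; have := @fsqrt_sub_sqr R e 0 x (leq0n e) xI.
by rewrite expr0n /= !subr0.
Qed.

(** * The slope of the period on a critical interval *)

Lemma Pinv_sub (R : realType) (x y : R) : fsqrt x = fsqrt y ->
  Pinv x - Pinv y = (x - y) / (2 * (fsqrt x)%:R + 1).
Proof. by rewrite /Pinv => <-; rewrite -mulrBl; congr (_ / _); ring. Qed.

(** The slope, on the critical interval of [e], of the [n]-th summand of
[period]: [Pinv (alpha - n^2)] has slope [1 / (2 k + 1)]. *)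
Definition edge_weight (R : realType) (e n : nat) : R :=
  ((2 * (fsqrt (e%:R - n%:R ^+ 2 : R))%:R + 1) * (4 * n%:R ^+ 2 - 1))^-1.

Definition slope (R : realType) (e : nat) : R :=
  let m := fsqrt (e%:R / 2 : R) in
  4 / (2 * m%:R + 1) ^+ 2
  - 16 * \sum_(m.+1 <= n < (fsqrt (e%:R : R)).+1) edge_weight R e n.

Lemma period_affine (R : realType) (e : nat) (x y : R) :
  e%:R <= x < (next_crit e)%:R -> e%:R <= y < (next_crit e)%:R ->
  period x - period y = slope R e * (x - y).
Proof.
move=> xI yI; rewrite /period /slope.
rewrite !(fsqrt_half xI) !(fsqrt_half yI) !(fsqrt_crit xI) !(fsqrt_crit yI).
set m := fsqrt (e%:R / 2); set N := fsqrt e%:R.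
have -> (p p' s s' q : R) : 8 * (p / q - 2 * s) - 8 * (p' / q - 2 * s') =
    8 * ((p - p') / q) - 16 * (s - s') by rewrite mulrBl; ring.
rewrite Pinv_sub ?(fsqrt_half xI) ?(fsqrt_half yI) // -/m -sumrB.
have m0 : (0 : R) <= m%:R by [].
rewrite [RHS]mulrBl; congr (_ - _); first by field; rewrite gt_eqF //; lra.
rewrite -mulrA mulr_suml; congr (_ * _).
apply: eq_big_nat => n /andP[_]; rewrite ltnS => nN.
have ne : (n ^ 2 <= e)%N.
  by rewrite -(ler_nat R) natrX -fsqrt_geE.
rewrite -mulrBl Pinv_sub ?(fsqrt_sub_sqr ne xI) ?(fsqrt_sub_sqr ne yI) //.
rewrite /edge_weight invfM; ring.
Qed.

Lemma dperiodE (R : realType) (e : nat) : dperiod R e = slope R e.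
Proof.
have itvP (a : R) : crit_itv e a -> e%:R < a < (next_crit e)%:R.
  by rewrite /crit_itv /= in_itv.
have der (a : R) : crit_itv e a -> is_derive a 1 (@period R) (slope R e).
  move=> aI; have /andP[a1 a2] := itvP _ aI.
  (* near [a], the period coincides with this affine function *)
  have lin : is_derive a 1 (fun z : R => period a + slope R e * (z - a))
      (slope R e).
    apply: is_derive_eq; rewrite /GRing.scale /=; ring.
  apply: near_eq_is_derive lin; near=> z.
  have /andP[z1 z2] : e%:R < z < (next_crit e)%:R.
    by apply/andP; split; near: z; [exact: lt_nbhsr|exact: lt_nbhsl].
  by rewrite -(@period_affine R e) ?subrKC // ?ltW //= ?ltW.
rewrite /dperiod; case: xgetP => [c _ cP|noc]; last first.
  by case: (noc (slope R e)).
have en : (e%:R : R) < (next_crit e)%:R by rewrite ltr_nat next_crit_gt.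
have mid : crit_itv e ((e%:R + (next_crit e)%:R) / 2 : R).
  by rewrite /crit_itv /= in_itv /=; apply/andP; split; lra.
by have <- := @derive_val _ _ _ _ _ _ _ (cP _ mid); have <- := @derive_val _ _ _ _ _ _ _ (der _ mid).
Unshelve. all: end_near. Qed.

(** The normalisation of [kappa] turns the first term of the slope into the
constant [- 2], which the sum over the edges has to balance. *)
Lemma kappaE (R : realType) (e : nat) :
  let m := fsqrt (e%:R / 2 : R) in
  kappa R e = - 2 + 8 * (2 * m%:R + 1) ^+ 2 *
    \sum_(m.+1 <= n < (fsqrt (e%:R : R)).+1) edge_weight R e n.
Proof.
move=> m; rewrite /kappa dperiodE /slope -/m.
have m0 : (0 : R) <= m%:R by [].
by field; rewrite gt_eqF //; lra.
Qed.

(** * A telescoping substitute for the integral *)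

Definition height (R : rcfType) (E x : R) : R := Num.sqrt (E - x ^+ 2).

(** The inequality between arithmetic and geometric means for two consecutive
heights; both bounds on the drop of [height E x / x] reduce to it. *)
Lemma height_amgm (R : rcfType) (E x : R) : 0 < x -> (x + 1) ^+ 2 <= E ->
  [/\ height E x ^+ 2 = E - x ^+ 2,
      height E (x + 1) ^+ 2 = E - (x + 1) ^+ 2 &
      2 * (height E x * height E (x + 1)) <= 2 * (E - x ^+ 2 - x) - 1].
Proof.
move=> x0 xE.
have aE : height E x ^+ 2 = E - x ^+ 2 by rewrite sqr_sqrtr //; lra.
have cE : height E (x + 1) ^+ 2 = E - (x + 1) ^+ 2 by rewrite sqr_sqrtr //; lra.
split=> //; have := sqr_ge0 (height E x - height E (x + 1)).
rewrite sqrrB; lra.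
Qed.

Lemma height_ratio_drop (R : rcfType) (E x : R) : 0 < x ->
  height E x / x - height E (x + 1) / (x + 1) =
  ((x + 1) * height E x - x * height E (x + 1)) / (x * (x + 1)).
Proof. by move=> x0; field; rewrite !gt_eqF //; lra. Qed.

(** A discrete form of the fact that [height E x / x] has derivative
[- E / (x ^+ 2 * height E x)]; together with [height_drop_le] it compares the
sum over the edges with a telescoping sum. *)
Lemma height_drop_ge (R : rcfType) (E x : R) : 0 < x -> (x + 1) ^+ 2 <= E ->
  E / (x * (x + 1) * height E x)
    <= height E x / x - height E (x + 1) / (x + 1).
Proof.
move=> x0 xE; rewrite height_ratio_drop //.
have [aE _ ac] := height_amgm x0 xE.
have a0 : 0 < height E x by rewrite sqrtr_gt0; lra.
have xx : 0 < x * (x + 1) by rewrite mulr_gt0 //; lra.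
rewrite [x * (x + 1) * _]mulrC invfM [E * _]mulrA ler_pM2r ?invr_gt0 // ler_pdivrMr //.
move: (height E x) (height E (x + 1)) aE ac {a0} => a c aE ac.
have -> : ((x + 1) * a - x * c) * a = (x + 1) * a ^+ 2 - x * (a * c) by ring.
have := ler_wpM2l (ltW x0) ac; rewrite aE; lra.
Qed.

Lemma height_drop_le (R : rcfType) (E x : R) : 0 < x -> (x + 1) ^+ 2 < E ->
  height E x / x - height E (x + 1) / (x + 1)
    <= E / (x * (x + 1) * height E (x + 1)).
Proof.
move=> x0 xE; rewrite height_ratio_drop //.
have [_ cE ac] := height_amgm x0 (ltW xE).
have c0 : 0 < height E (x + 1) by rewrite sqrtr_gt0; lra.
have x1 : 0 < x + 1 by lra.
have xx : 0 < x * (x + 1) by rewrite mulr_gt0.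
rewrite [x * (x + 1) * _]mulrC [in leRHS]invfM [in leRHS]mulrA ler_pM2r ?invr_gt0 // ler_pdivlMr //.
move: (height E x) (height E (x + 1)) cE ac {c0} => a c cE ac.
have -> : ((x + 1) * a - x * c) * c = (x + 1) * (a * c) - x * c ^+ 2 by ring.
have := ler_wpM2l (ltW x1) ac; rewrite cE; lra.
Qed.

(** [weight_le] and [weight_ge] replace the integer [k] by the height [s], and
[4 x ^+ 2 - 1] by the product [4 x (x + 1)] that fits the telescoping bounds.
Each replacement costs a relative error [u], which has to dominate both
[1 / s] and [2 / n], where [n] is the index of the edge: [n = x] in the upper
bound and [n = x + 1] in the lower one. *)
Lemma weight_le (R : realFieldType) (s k x u : R) :
  0 < u <= 1 -> 1 <= u * s -> 2 <= u * x -> 0 <= k -> s < k + 1 ->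
  8 / ((2 * k + 1) * (4 * x ^+ 2 - 1)) <= (1 + u) ^+ 2 / (x * (x + 1) * s).
Proof.
move=> /andP[u0 u1] us ux k0 sk.
have s0 : 0 < s by rewrite -(pmulr_rgt0 _ u0); lra.
have x0 : 0 < x by rewrite -(pmulr_rgt0 _ u0); lra.
have xx0 : 0 < x * (x + 1) by apply: mulr_gt0; lra.
have x2 : 2 <= x by have : u * x <= 1 * x; [rewrite ler_pM2r|lra].
have x4 : 4 <= x ^+ 2 by rewrite expr2; nra.
have h1 : 2 / (2 * k + 1) <= (1 + u) / s.
  rewrite ler_pdivrMr; last by lra.
  rewrite mulrAC ler_pdivlMr //.
  have : u * s <= u * (k + 1) by rewrite ler_pM2l // ltW.
  lra.
have h2 : 4 / (4 * x ^+ 2 - 1) <= (1 + u) / (x * (x + 1)).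
  rewrite ler_pdivrMr; last by lra.
  rewrite mulrAC ler_pdivlMr //.
  have : 2 * x <= u * x * x by rewrite ler_pM2r.
  lra.
have -> : 8 / ((2 * k + 1) * (4 * x ^+ 2 - 1)) =
    2 / (2 * k + 1) * (4 / (4 * x ^+ 2 - 1)).
  by rewrite mulf_div; congr (_ / _); ring.
have -> : (1 + u) ^+ 2 / (x * (x + 1) * s) =
  (1 + u) / s * ((1 + u) / (x * (x + 1))).
  by rewrite mulf_div; congr (_ / _); ring.
by apply: ler_pM => //; apply: divr_ge0; lra.
Qed.

Lemma weight_ge (R : realFieldType) (s k x u : R) :
  0 < u <= 1 -> 1 <= u * s -> 2 <= u * (x + 1) -> 0 <= k <= s ->
  (1 - u) ^+ 2 / (x * (x + 1) * s) <=
    8 / ((2 * k + 1) * (4 * (x + 1) ^+ 2 - 1)).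
Proof.
move=> /andP[u0 u1] us ux /andP[k0 ks].
have s0 : 0 < s by rewrite -(pmulr_rgt0 _ u0); lra.
have x0 : 0 < x + 1 by rewrite -(pmulr_rgt0 _ u0); lra.
have x1 : 1 <= x.
  by have : u * (x + 1) <= 1 * (x + 1); [rewrite ler_pM2r|lra].
have xx0 : 0 < x * (x + 1) by apply: mulr_gt0; lra.
have x4 : 1 <= x ^+ 2 by rewrite expr2; nra.
have h1 : (1 - u) / s <= 2 / (2 * k + 1).
  rewrite ler_pdivrMr // mulrAC ler_pdivlMr; last by lra.
  have : (1 - u) * (2 * k + 1) <= (1 - u) * (2 * s + 1).
    by apply: ler_wpM2l; lra.
  lra.
have h2 : (1 - u) / (x * (x + 1)) <= 4 / (4 * (x + 1) ^+ 2 - 1).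
  rewrite ler_pdivrMr // mulrAC ler_pdivlMr; last by lra.
  have : 2 * (x + 1) <= u * (x + 1) * (x + 1) by rewrite ler_pM2r.
  lra.
have -> : 8 / ((2 * k + 1) * (4 * (x + 1) ^+ 2 - 1)) =
    2 / (2 * k + 1) * (4 / (4 * (x + 1) ^+ 2 - 1)).
  by rewrite mulf_div; congr (_ / _); ring.
have -> : (1 - u) ^+ 2 / (x * (x + 1) * s) =
  (1 - u) / s * ((1 - u) / (x * (x + 1))).
  by rewrite mulf_div; congr (_ / _); ring.
by apply: ler_pM => //; apply: divr_ge0; lra.
Qed.

(** * The edges away from the last one *)

(** The real number [u] stands for [1 / sqrt N]; it is the size of all errors
below. *)
Lemma size_bounds (R : realType) (e : nat) (u : R) :
  let E : R := e%:R in let N := fsqrt E in let m := fsqrt (E / 2) in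
  0 < u <= 1 / 4 -> u ^+ 2 * N%:R = 1 ->
  [/\ N%:R ^+ 2 <= E < (N%:R + 1) ^+ 2,
      m%:R ^+ 2 <= E / 2 < (m%:R + 1) ^+ 2,
      4 <= u * N%:R, 16 <= N%:R :> R &
      16 * N%:R <= N%:R ^+ 2 :> R /\ (m < N)%N].
Proof.
move=> E N m /andP[u0 u4] uN.
have E0 : 0 <= E by [].
have NI := fsqrt_sqr_itv E0; rewrite -/N in NI.
have /andP[NE EN] := NI.
have mI : m%:R ^+ 2 <= E / 2 < (m%:R + 1) ^+ 2.
  by apply: fsqrt_sqr_itv; lra.
have /andP[mE Em] := mI.
have uuN : u * (u * N%:R) = 1 by rewrite mulrA -expr2.
have uN4 : 4 <= u * N%:R.
  have : u * (u * N%:R) <= 1 / 4 * (u * N%:R)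
    by apply: ler_wpM2r => //; rewrite pmulr_rge0.
  lra.
have N16 : 16 <= N%:R :> R.
  have : u * N%:R <= 1 / 4 * N%:R by apply: ler_wpM2r.
  lra.
have NN : 16 * N%:R <= N%:R ^+ 2 :> R by rewrite expr2; apply: ler_wpM2r.
split=> //; split=> //.
rewrite -(ltr_nat R) -ltr_sqr ?nnegrE //; lra.
Qed.

Definition height_ratio (R : rcfType) (E : R) (n : nat) : R :=
  height E n%:R / n%:R.

(** The edges [m < n < N] telescope to the drop of [height_ratio] from about
[sqrt (E / 2)], where it is 1, to about [sqrt E], where it vanishes. *)
Lemma inner_sum_approx (R : realType) (e : nat) (u : R) :
  let E : R := e%:R in let N := fsqrt E in let m := fsqrt (E / 2) in
  0 < u <= 1 / 4 -> u ^+ 2 * N%:R = 1 ->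
  `|8 * E * (\sum_(m.+1 <= n < N) edge_weight R e n) - 1| <= 6 * u.
Proof.
move=> E N m uI uN; have /andP[u0 u4] := uI.
have [NI mI uN4 N16 [NN mN]] := size_bounds uI uN.
rewrite -/E -/N -/m in NI mI uN4 N16 NN mN.
have /andP[NE EN] := NI; have /andP[mE Em] := mI.
have E0 : 0 <= E by [].
have m2 : N%:R <= 2 * (m%:R + 1) :> R.
  rewrite -ler_sqr ?nnegrE // exprMn.
  have := sqr_ge0 (m%:R + 1 : R); lra.
have m0 : 1 <= m%:R :> R by lra.
(* [E - n^2 >= N^2 - (N - 1)^2 >= N = 1 / u^2] *)
have hle (n : nat) : (n < N)%N -> 1 <= u * height E n%:R.
  move=> nN; have : n%:R + 1 <= N%:R :> R by rewrite natr1 ler_nat.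
  have n0 : 0 <= n%:R :> R by [].
  move=> n1; have nn : (n%:R + 1) ^+ 2 <= N%:R ^+ 2 :> R.
    by rewrite ler_sqr ?nnegrE //.
  have h0 : 0 <= u * height E n%:R by rewrite pmulr_rge0 ?sqrtr_ge0.
  rewrite -ler_sqr ?nnegrE // expr1n exprMn /height sqr_sqrtr; last lra.
  rewrite -[leLHS]uN; apply: ler_wpM2l; first exact: sqr_ge0.
  have : n%:R ^+ 2 <= (N%:R - 1) ^+ 2 :> R by rewrite ler_sqr ?nnegrE; lra.
  lra.
have uge (n : nat) : (m < n)%N -> 2 <= u * n%:R.
  move=> mn; have : m%:R + 1 <= n%:R :> R by rewrite natr1 ler_nat.
  move=> mn'; have : u * N%:R <= u * (2 * n%:R) by rewrite ler_pM2l //; lra.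
  lra.
have kitv (n : nat) : (n < N)%N ->
    (fsqrt (E - n%:R ^+ 2))%:R <= height E n%:R
      < (fsqrt (E - n%:R ^+ 2))%:R + 1.
  move=> nN; apply: fsqrt_itv.
  have : n%:R ^+ 2 <= N%:R ^+ 2 :> R.
    by rewrite ler_sqr ?nnegrE // ler_nat ltnW.
  lra.
pose F := height_ratio E.
have Nsqr (n : nat) : (n < N)%N -> n%:R ^+ 2 < E.
  move=> nN; apply: lt_le_trans NE.
  by rewrite ltr_sqr ?nnegrE // ltr_nat.
have m1E : (m%:R + 1) ^+ 2 <= E.
  by apply: le_trans NE; rewrite ler_sqr ?nnegrE // natr1 ler_nat.
(* [m <= sqrt (E / 2) < m + 1] puts 1 between the ratios at [m + 1] and [m] *)
have Fm1 : F m.+1 <= 1.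
  rewrite /F /height_ratio -natr1 ler_pdivrMr; last lra.
  rewrite mul1r -ler_sqr ?nnegrE ?sqrtr_ge0 //.
  rewrite sqr_sqrtr; lra.
have Fm : 1 <= F m.
  rewrite /F /height_ratio ler_pdivlMr; last lra.
  rewrite mul1r -ler_sqr ?nnegrE ?sqrtr_ge0 //.
  rewrite sqr_sqrtr; lra.
have FN : 0 <= F N by rewrite divr_ge0 // sqrtr_ge0.
have FN1 : F N.-1 <= 4 * u.
  have EN1 : N.-1%:R = N%:R - 1 :> R by rewrite -subn1 natrB // (leq_trans _ mN).
  rewrite /F /height_ratio EN1 ler_pdivrMr; last lra.
  have u2 := sqr_ge0 u.
  have uNN : u ^+ 2 * N%:R ^+ 2 = N%:R by rewrite [N%:R ^+ 2]expr2 mulrA uN mul1r.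
  rewrite -ler_sqr ?nnegrE ?sqrtr_ge0 //; last by rewrite !mulr_ge0 //; lra.
  rewrite sqr_sqrtr; last by lra.
  have -> : (4 * u * (N%:R - 1)) ^+ 2 =
    16 * (u ^+ 2 * N%:R ^+ 2 - 2 * (u ^+ 2 * N%:R) + u ^+ 2) by ring.
  rewrite uN uNN; lra.
have u01 : 0 < u <= 1 by apply/andP; split; lra.
rewrite ler_norml mulrAC mulr_sumr mulr_suml; apply/andP; split.
(* (1 - u)^2 (1 - 4 u) is at least 1 - 6 u *)
- have low (n : nat) : (m.+1 <= n < N)%N ->
      (1 - u) ^+ 2 * (F n.-1 - F n) <= 8 * edge_weight R e n * E.
    case: n => // n /andP[mn nN] /=.
    have n0 : 0 < n%:R :> R.
      by apply: lt_le_trans (_ : m%:R <= _); [lra|rewrite ler_nat].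
    have n1E : (n%:R + 1) ^+ 2 < E by rewrite natr1 Nsqr.
    have hd := height_drop_le n0 n1E.
    have kI := kitv _ nN; have ul := hle _ nN; have ug := uge _ mn.
    have := @weight_ge R (height E n.+1%:R) (fsqrt (E - n.+1%:R ^+ 2))%:R n%:R u.
    rewrite natr1 in hd; rewrite !natr1 => /(_ u01 ul ug).
    have /andP[kI1 _] := kI; rewrite ler0n kI1 => /(_ isT) wg.
    have := ler_wpM2r E0 wg; rewrite -/(edge_weight R e n.+1).
    apply: le_trans; rewrite [leRHS]mulrAC -[leRHS]mulrA; apply: ler_wpM2l => //.
    exact: sqr_ge0.
  have := ler_sum_nat low; rewrite -mulr_sumr.
  have -> : \sum_(m.+1 <= i < N) (F i.-1 - F i) = - F N.-1 + F m.
    rewrite (@telescope_sumr_eq _ _ _ (fun k => - F k.-1)) // ?opprK //.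
    by move=> k _; rewrite opprK addrC.
  set S := \sum_(_ <= _ < _) _ => lowS.
  have : (1 - u) ^+ 2 * (1 - 4 * u) <= (1 - u) ^+ 2 * (- F N.-1 + F m).
    by apply: ler_wpM2l; [exact: sqr_ge0|lra].
  have : 0 <= u ^+ 2 * (9 - 4 * u) by apply: mulr_ge0; [exact: sqr_ge0|lra].
  lra.
(* (1 + u)^2 is at most 1 + 6 u *)
- have upp (n : nat) : (m.+1 <= n < N)%N ->
      8 * edge_weight R e n * E <= (1 + u) ^+ 2 * (F n - F n.+1).
    move=> /andP[mn nN].
    have n0 : 0 < n%:R :> R.
      by apply: lt_le_trans (_ : m%:R <= _); [lra|rewrite ler_nat ltnW].
    have n1E : (n%:R + 1) ^+ 2 <= E.
      apply: le_trans NE; rewrite ler_sqr ?nnegrE // ?natr1 ?ler_nat //.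
    have hd := height_drop_ge n0 n1E.
    have /andP[kI1 kI2] := kitv _ nN; have ul := hle _ nN; have ug := uge _ mn.
    have wl := @weight_le R (height E n%:R) (fsqrt (E - n%:R ^+ 2))%:R n%:R u
      u01 ul ug (ler0n _ _) kI2.
    have := ler_wpM2r E0 wl; rewrite -/(edge_weight R e n) => /le_trans; apply.
    rewrite natr1 in hd *; rewrite [leLHS]mulrAC -[leLHS]mulrA; apply: ler_wpM2l => //.
    exact: sqr_ge0.
  have := ler_sum_nat upp; rewrite -mulr_sumr.
  have -> : \sum_(m.+1 <= i < N) (F i - F i.+1) = - F N + F m.+1.
    rewrite (@telescope_sumr_eq _ _ _ (fun k => - F k)) // ?opprK //.
    by move=> k _; rewrite opprK addrC.
  set S := \sum_(_ <= _ < _) _ => uppS.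
  have : (1 + u) ^+ 2 * (- F N + F m.+1) <= (1 + u) ^+ 2 * 1.
    by apply: ler_wpM2l; [exact: sqr_ge0|lra].
  have : 0 <= u * (4 - u) by apply: mulr_ge0; lra.
  lra.
Qed.

(** * The last edge *)

(** With [q ~ 2], [T ~ 1] and [p ~ 2], the value of [kappa] is
[- 2 + q (T + p g)], where [g = 1 / (2 k_N + 1)] comes from the edge [n = N];
so the edges before it cancel the constant and [4 g] is left. *)
Lemma kappa_approx (R : realType) (e : nat) (u : R) :
  let E : R := e%:R in let N := fsqrt E in
  0 < u <= 1 / 4 -> u ^+ 2 * N%:R = 1 ->
  `|kappa R e - 4 / (2 * (fsqrt (E - N%:R ^+ 2))%:R + 1)| <= 70 * u.
Proof.
move=> E N uI uN; have /andP[u0 u4] := uI.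
pose m := fsqrt (E / 2); pose k := fsqrt (E - N%:R ^+ 2).
have Sa := inner_sum_approx uI uN; rewrite -/E -/N -/m in Sa.
have [NI mI uN4 N16 [NN mN]] := size_bounds uI uN.
rewrite -/E -/N -/m in NI mI uN4 N16 NN mN.
have /andP[NE EN] := NI; have /andP[mE Em] := mI.
have E0 : 0 <= E by [].
have uNN : 4 * N%:R <= u * N%:R ^+ 2 by rewrite [N%:R ^+ 2]expr2 mulrA; apply: ler_wpM2r.
have uE : u * N%:R ^+ 2 <= u * E by rewrite ler_pM2l.
have m0 : 0 <= m%:R :> R by [].
have mNR : m%:R <= N%:R :> R by rewrite ler_nat ltnW.
have Ep : 0 < E by lra.
pose q := (2 * m%:R + 1) ^+ 2 / E.
have qa : `|q - 2| <= 6 * u.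
  rewrite ler_distl /q ler_pdivlMr // ler_pdivrMr //.
  apply/andP; split; lra.
pose p := 8 * E / (4 * N%:R ^+ 2 - 1).
have pa : `|p - 2| <= 8 * u.
  rewrite ler_distl /p ler_pdivlMr ?ler_pdivrMr; [|lra|lra].
  apply/andP; split; lra.
pose g : R := (2 * k%:R + 1)^-1.
have k0 : 0 <= k%:R :> R by [].
have /andP[g0 g1] : 0 <= g <= 1.
  have k1 : 0 < 2 * k%:R + 1 :> R by lra.
  by apply/andP; split; [rewrite invr_ge0 ltW|rewrite invf_le1 //; lra].
rewrite kappaE -/E -/N -/m big_nat_recr //= -/(edge_weight R e N).
set S := \sum_(_ <= _ < _) _ in Sa *.
have -> : edge_weight R e N = g / (4 * N%:R ^+ 2 - 1) by rewrite /edge_weight invfM.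
pose T := 8 * E * S.
have -> : - 2 + 8 * (2 * m%:R + 1) ^+ 2 * (S + g / (4 * N%:R ^+ 2 - 1))
    - 4 / (2 * k%:R + 1) =
    (q - 2) * (T + p * g) + 2 * (T - 1) + 2 * (p - 2) * g.
  rewrite /T /p /q -/g.
  by field; apply/andP; split; rewrite gt_eqF //; lra.
rewrite -/T in Sa.
move: q p T g qa pa Sa g0 g1 => q p T g qa pa Ta g0 g1.
have Tp : `|T + p * g| <= 13 / 2.
  apply: le_trans (ler_normD _ _) _.
  have : `|T| <= 5 / 2.
    by move: Ta; rewrite ler_distl ler_norml => /andP[? ?]; apply/andP; split; lra.
  have : `|p * g| <= 4 * 1.
    rewrite normrM ler_pM //; last by rewrite ger0_norm.
    by move: pa; rewrite ler_distl ler_norml => /andP[? ?]; apply/andP; split; lra.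
  lra.
have h1 : `|(q - 2) * (T + p * g)| <= 6 * u * (13 / 2) by rewrite normrM ler_pM.
have h2 : `|2 * (T - 1)| <= 2 * (6 * u) by rewrite normrM ger0_norm // ler_pM2l.
have h3 : `|2 * (p - 2) * g| <= 2 * (8 * u) * 1.
  rewrite !normrM [`|2|]ger0_norm // [`|g|]ger0_norm // ler_pM ?mulr_ge0 //.
  by rewrite ler_pM2l.
apply: le_trans (ler_normD _ _) _.
have := ler_normD ((q - 2) * (T + p * g)) (2 * (T - 1)); lra.
Qed.

(** * The critical number of (n + b)^2 *)

(** The critical number wanted is the largest one not exceeding
[(n + b) ^+ 2]. *)
Lemma crit_atP (R : realType) (n : nat) (b : R) : 0 <= b ->
  let e := crit_at n b in e%:R <= (n%:R + b) ^+ 2 < (next_crit e)%:R.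
Proof.
move=> b0; set x := (n%:R + b) ^+ 2.
have x0 : 0 <= x by apply: sqr_ge0.
pose below := [pred c | `[< crit c >] && (c <= Num.truncn x)%N].
have ex_below : exists c, below c.
  by exists 0%N; rewrite /= andbT; apply/asboolP; apply: (crit_sum2 0 0).
have below_le c : below c -> (c <= Num.truncn x)%N by case/andP.
rewrite /= /crit_at -/x; case: xgetP => [e _ [_ eI]|].
  case: eI => [/= ->|]; last by rewrite /crit_itv /= in_itv /= => /andP[/ltW-> ->].
  by rewrite lexx ltr_nat next_crit_gt.
case: (ex_maxnP ex_below below_le) => e /andP[/asboolP ce ex] emax.
move=> /(_ e) []; split=> //.
have ex' : e%:R <= x by rewrite -truncn_ge_nat.
have xn : x < (next_crit e)%:R.
  rewrite ltNge -truncn_ge_nat //; apply/negP => nx.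
  have := next_crit_gt e; rewrite ltnNge => /negP; apply; apply: emax.
  rewrite /= nx andbT /next_crit.
  by case: ex_minnP => m /andP[].
rewrite /crit_itv /= in_itv /= xn andbT.
by move: ex'; rewrite le_eqVlt => /orP[/eqP|] ?; [left|right].
Qed.

Lemma fsqrt_crit_at (R : realType) (n : nat) (b : R) : 0 <= b < 1 ->
  fsqrt ((crit_at n b)%:R : R) = n.
Proof.
move=> /andP[b0 b1]; have xI := crit_atP n b0.
rewrite -(fsqrt_crit xI) /fsqrt sqrtr_sqr ger0_norm; last by rewrite addr_ge0.
by apply: truncn_def; rewrite -natr1; apply/andP; split; lra.
Qed.

Lemma fsqrt_crit_at_sub (R : realType) (n : nat) (b : R) : 0 <= b < 1 ->
  fsqrt ((crit_at n b)%:R - n%:R ^+ 2 : R) = fsqrt (2 * n%:R * b + b ^+ 2).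
Proof.
move=> bI; have /andP[b0 b1] := bI; have xI := crit_atP n b0.
rewrite -(@fsqrt_sub_sqr R _ n _ _ xI); last first.
  by rewrite -(ler_nat R) natrX -fsqrt_geE // fsqrt_crit_at.
by congr fsqrt; ring.
Qed.

(** * The limit *)

Lemma cvg_invsqrt_bound (R : realType) (f : nat -> R) (l C : R) (n0 : nat) :
  (forall n, (n0 < n)%N -> `|f n - l| <= C * (Num.sqrt n%:R)^-1) ->
  f n @[n --> \oo] --> l.
Proof.
move=> fl.
have u0 : (Num.sqrt n%:R)^-1 @[n --> \oo] --> (0 : R).
  apply/cvgr0Pnorm_lt => eps eps0; near=> n.
  have n1 : (eps^-1) ^+ 2 < n%:R by near: n; apply: nbhs_infty_gtr.
  have ie : 0 < eps^-1 by rewrite invr_gt0.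
  have s0 : 0 < Num.sqrt n%:R :> R by rewrite sqrtr_gt0 (le_lt_trans _ n1) // sqr_ge0.
  rewrite ger0_norm ?invr_ge0 ?sqrtr_ge0 // -[ltRHS]invrK ltf_pV2 ?posrE //.
  by rewrite -ltr_sqr ?nnegrE ?sqrtr_ge0 ?sqr_sqrtr // ltW.
have Cu : C * (Num.sqrt n%:R)^-1 @[n --> \oo] --> (0 : R).
  by rewrite -[X in _ --> X](mulr0 C); apply: cvgM; [exact: cvg_cst|].
have lo : l - C * (Num.sqrt n%:R)^-1 @[n --> \oo] --> l.
  by rewrite -[X in _ --> X]subr0; apply: cvgB; [exact: cvg_cst|].
have hi : l + C * (Num.sqrt n%:R)^-1 @[n --> \oo] --> l.
  by rewrite -[X in _ --> X]addr0; apply: cvgD; [exact: cvg_cst|].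
apply: (squeeze_cvgr _ lo hi); near=> n.
by rewrite -ler_distl; apply: fl; near: n; exact: nbhs_infty_gt.
Unshelve. all: end_near. Qed.

Theorem theorem4 (R : realType) (b : R) (hb0 : 0 <= b) (hb1 : b < 1) :
  kappa R (crit_at n b) @[n --> \oo] --> (if b == 0 then 4 else 0 : R).
Proof.
have bI : 0 <= b < 1 by rewrite hb0.
(* The first constant is the error in [kappa_approx]; the second bounds
   [4 / (2 k_N + 1)] times [sqrt n] for [0 < b], and for [b = 0] it is
   [4 / 0 = 0].  From [n = 16] on, [1 / sqrt n <= 1 / 4]. *)
apply: (@cvg_invsqrt_bound _ _ _ (70 + 4 / Num.sqrt (2 * b)) 15) => n n16.
set u := (Num.sqrt n%:R)^-1.
have n16R : 16 <= n%:R :> R by rewrite (ler_nat R 16).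
have s4 : 4 <= Num.sqrt n%:R :> R.
  rewrite -ler_sqr ?nnegrE ?sqrtr_ge0 // sqr_sqrtr //; lra.
have u0 : 0 < u by rewrite invr_gt0; lra.
have u4 : u <= 1 / 4 by rewrite div1r lef_pV2 ?posrE //; lra.
have uI : 0 < u <= 1 / 4 by rewrite u0.
have un : u ^+ 2 * n%:R = 1.
  by rewrite /u exprVn sqr_sqrtr // mulVf // gt_eqF //; lra.
have := @kappa_approx R (crit_at n b) u uI.
rewrite fsqrt_crit_at // fsqrt_crit_at_sub // => /(_ un) ka.
case: eqVneq => [b0|bN0].
  move: ka; rewrite /fsqrt b0 expr0n !(mulr0, addr0, sqrtr0, invr0) truncn0.
  by rewrite mulr0 add0r divr1.
have b0 : 0 < b by rewrite lt_def bN0.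
set k := fsqrt (2 * n%:R * b + b ^+ 2) in ka.
have nb0 : 0 <= 2 * n%:R * b by rewrite !mulr_ge0.
have x0 : 0 <= 2 * n%:R * b + b ^+ 2 by rewrite addr_ge0 // sqr_ge0.
have /andP[_ sk] := fsqrt_itv x0; rewrite -/k in sk.
have bs : Num.sqrt (2 * b) / u <= k%:R + 1.
  rewrite /u invrK -sqrtrM; last by lra.
  apply: le_trans (ltW sk); rewrite ler_sqrt //.
  by rewrite mulrAC lerDl sqr_ge0.
have k0 : 0 <= k%:R :> R by [].
have sb0 : 0 < Num.sqrt (2 * b) by rewrite sqrtr_gt0; lra.
have gle : 4 / (2 * k%:R + 1) <= 4 / Num.sqrt (2 * b) * u.
  rewrite -mulrA ler_pM2l // -[u]invrK -invfM mulrC lef_pV2 ?posrE; last 2 first.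
  - lra.
  - by rewrite mulr_gt0 // invr_gt0.
  by rewrite mulrC; lra.
have g0 : 0 <= 4 / (2 * k%:R + 1) :> R by rewrite divr_ge0 //; lra.
move: ka; rewrite subr0 [(70 + _) * u]mulrDl.
move: (4 / (2 * k%:R + 1)) (4 / Num.sqrt (2 * b) * u) gle g0 => g w gle g0.
rewrite ler_distl ler_norml => /andP[? ?]; apply/andP; split; lra.
Qed.
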